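(* Let $\mathcal{A}$ be a C*-algebra and let $\mathcal{B}$ be a C*-subalgebra of $\mathcal{A}$. Assume that $\mathcal{B}$ contains a bounded approximate identity for $\mathcal{A}$. For $A \in \mathcal{A}$ let $L(A) = \inf\{\|A-B\| : B \in \mathcal{B}\}$. Then $L$ is Leibniz, that is, $$L(AC) \leq L(A)\|C\| + \|A\|L(C)$$ for all $A, C \in \mathcal{A}$. If $\mathcal{A}$ is unital and if $1_{\mathcal{A}} \in \mathcal{B}$, then $L$ is strongly-Leibniz, that is, $L$ is Leibniz, $L(1_{\mathcal{A}}) = 0$, and if $A$ is invertible in $\mathcal{A}$ then $$L(A^{-1}) \leq \|A^{-1}\|^2 L(A).$$
   Context: C*-algebras are over $\mathbb{C}$ and C*-subalgebras are norm-closed $*$-subalgebras. $L$ is the quotient norm on $\mathcal{A}/\mathcal{B}$ pulled back to a seminorm on $\mathcal{A}$. *)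

(* Defs.v *)
From HB Require Import structures.
From mathcomp Require Import all_boot all_order all_algebra.
From mathcomp Require Import all_classical all_reals all_analysis.
From mathcomp Require Import complex.

Set Implicit Arguments.
Unset Strict Implicit.
Unset Printing Implicit Defensive.

Import Order.TTheory GRing.Theory Num.Theory.
Import numFieldNormedType.Exports.

Local Open Scope classical_set_scope.
Local Open Scope ring_scope.
Local Open Scope complex_scope.

(* C*-algebras need not be unital, so the product is the product of a
   [semigroupType] (written [( * )%g]) and not that of a ring. *)
HB.mixin Record CompleteNormedModule_isCStarAlgebra (R : realType) A
    & CompleteNormedModule R[i] A & Semigroup A := {
  star : A -> A;
  cstar_mulDl : forall x y z : A, ((x + y)%R * z)%g = (x * z)%g + (y * z)%g;
  cstar_mulDr : forall x y z : A, (x * (y + z)%R)%g = (x * y)%g + (x * z)%g;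
  cstar_mulZl : forall (k : R[i]) (x y : A), ((k *: x)%R * y)%g = k *: (x * y)%g;
  cstar_mulZr : forall (k : R[i]) (x y : A), (x * (k *: y)%R)%g = k *: (x * y)%g;
  cstar_normM : forall x y : A, `|(x * y)%g| <= `|x| * `|y|;
  starK : involutive star;
  starD : {morph star : x y / x + y};
  starZ : forall (k : R[i]) (x : A), star (k *: x) = k^* *: star x;
  starM : forall x y : A, star (x * y)%g = (star y * star x)%g;
  cstar_identity : forall x : A, `|(star x * x)%g| = `|x| ^+ 2
}.

#[short(type="cstarAlgType")]
HB.structure Definition CStarAlgebra (R : realType) :=
  {A of CompleteNormedModule R[i] A & Semigroup A
      & CompleteNormedModule_isCStarAlgebra R A}.

Section CStarAlgebras.
Context {R : realType} {A : cstarAlgType R}.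
Implicit Types (a b e : A) (B : set A) (L : A -> R).

(* [`|a|] is a nonnegative real number, but it has type [R[i]]. *)
Definition cnorm a : R := complex.Re `|a|.

Lemma cnormE a : (cnorm a)%:C = `|a|.
Proof. by rewrite /cnorm RRe_real ?normr_real. Qed.

Record cstar_subalgebra B : Prop := {
  cstar_sub0 : B 0;
  cstar_subD : forall x y, B x -> B y -> B (x + y);
  cstar_subZ : forall (k : R[i]) x, B x -> B (k *: x);
  cstar_subM : forall x y, B x -> B y -> B (x * y)%g;
  cstar_sub_star : forall x, B x -> B (star x);
  cstar_sub_closed : closed B
}.

Record directed (I : Type) (le : I -> I -> Prop) : Prop := {
  directed_ex : exists i : I, True;
  directed_refl : forall i, le i i;
  directed_trans : forall i j k, le i j -> le j k -> le i k;
  directed_ub : forall i j, exists k, le i k /\ le j k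
}.

Definition eventually_of (I : Type) (le : I -> I -> Prop) : set_system I :=
  filter_from setT (fun i => [set j | le i j]).

Definition bounded_approximate_identity
    (I : Type) (le : I -> I -> Prop) (u : I -> A) : Prop :=
  [/\ directed le,
      exists M : R, forall i, cnorm (u i) <= M,
      forall a, (u i * a)%g @[i --> eventually_of le] --> a
    & forall a, (a * u i)%g @[i --> eventually_of le] --> a].

Definition contains_bounded_approximate_identity B : Prop :=
  exists (I : Type) (le : I -> I -> Prop) (u : I -> A),
    (forall i, B (u i)) /\ bounded_approximate_identity le u.

Definition quotient_seminorm B a : R := inf [set cnorm (a - b) | b in B].

Definition leibniz L : Prop :=
  forall a c, L (a * c)%g <= L a * cnorm c + cnorm a * L c.

Definition is_one e : Prop := forall a, (e * a)%g = a /\ (a * e)%g = a.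

Definition is_inverse e a a' : Prop := (a * a')%g = e /\ (a' * a)%g = e.

Definition strongly_leibniz e L : Prop :=
  [/\ leibniz L, L e = 0
    & forall a a', is_inverse e a a' -> L a' <= cnorm a' ^+ 2 * L a].

End CStarAlgebras.

(* Main.v *)
From HB Require Import structures.
Require Import Defs.
From mathcomp Require Import all_boot all_order all_algebra.
From mathcomp Require Import all_classical all_reals all_analysis.
From mathcomp Require Import complex ring lra.

(** Both inequalities come from one functional.  If [m] is at most the distance
    from [a] to the subspace [B], there are real-linear functionals [f] and
    [phi] on the algebra with [f = 0] on [B], [m <= f a], [phi] positive of norm
    at most one, and [|f (y x)| <= |y| phi(x* x)^(1/2)] for all [x], [y]
    ([separating_functional]).  So [f] behaves like a vector functional
    [x |-> <x xi, eta>] on the Hilbert space of [phi], where [eta] is orthogonal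
    to [B xi].

    For the Leibniz inequality let [p] in [B] be the orthogonal projection of
    [c] onto [B] in the seminorm of [phi].  Since [f (b p) = 0] for [b] in [B],
    [f (a c) = f (a (c - p)) + f ((a - b) p)].  In that seminorm [c - p] is at
    most as long as [c - d] for [d] in [B], and [p] at most as long as [c]; this
    bounds [f (a c)] by [|a| |c - d| + |a - b| |c|] for all [b], [d] in [B]
    ([functional_mul_le]).

    For the inverse [x] of [a], let [s] be the reflection in the closure of [B].
    It is isometric for the seminorm of [phi] and commutes with left
    multiplication by elements of [B], because [B] is closed under products and
    the involution.  With [t = a - b], this gives
    [2 f x = f (x s(t x)) - f (x t s(x))], and both terms are bounded by
    [|x|^2 |t|] ([functional_inv_le]).  The projections need not exist in [B],
    so near-projections are used ([near_projection]), with a passage to the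
    limit.

    The pair [(f, phi)] comes from a single application of the Hahn-Banach
    theorem to the gauge
    [(v, h) |-> inf (|h + k| + r) / 2] over all [w], [k], [r] with [w* w <= r k]
    and [w - v] in [B].  Linear functionals below that gauge have the required
    properties because [(y x)* (y x) <= |y|^2 x* x], and the gauge at [(a, 0)] is
    at least the distance to [B] because [w* w <= r k] forces [|w|^2 <= r |k|].
    These facts rest on the positivity of [x* x] ([pos_star_mul]),
    which is derived from the axioms through square roots of hermitian elements.
    Spectra are avoided: an element is called positive when it lies within
    [t] of a scalar [t >= 0].

    The order is easiest to handle in the presence of a unit, so everything takes
    place in an abstract unital C*-algebra, and the given algebra is embedded
    isometrically in its unitization.  A unit of the given algebra is not the
    unit of the unitization; therefore [functional_inv_le] speaks of a local
    unit [u] of [B]. *)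

Set Implicit Arguments.
Unset Strict Implicit.
Unset Printing Implicit Defensive.

Import Order.TTheory GRing.Theory Num.Theory.
Import numFieldNormedType.Exports.

Local Open Scope classical_set_scope.
Local Open Scope ring_scope.

(** Identities between signed sums of the same terms of an additive group.  The
    difference of the two sides is flattened, and each leading term is cancelled
    against its opposite. *)
Ltac zmod_cancel :=
  apply/eqP; rewrite -subr_eq0; apply/eqP;
  rewrite ?(opprB, opprD, opprK, oppr0) -[LHS]addr0 -?addrA;
  repeat match goal with
  | |- - ?g + _ = _ =>
      repeat (progress rewrite (addrCA _ g)); rewrite (addNKr g)
  | |- ?h + _ = _ =>
      repeat (progress rewrite (addrCA _ (- h))); rewrite (addKr h)
  | |- 0 + _ = _ => rewrite [LHS]add0r
  | |- 0 = 0 => reflexivity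
  end.

(** * Two limiting arguments for real numbers *)

(** The value [s = m / sqrt q] gives the bound; it is approached by
    [(m + e) / (sqrt q + e)] so that [q] and [m] may vanish. *)
Lemma le_mul_sqrt (R : realType) (f q m : R) : 0 <= q -> 0 <= m ->
  (forall s : R, 0 < s -> 2 * f <= s * q + s^-1 * m ^+ 2) -> f <= m * Num.sqrt q.
Proof.
move=> q0 m0 h; set s := Num.sqrt q.
have s0 : 0 <= s by exact: sqrtr_ge0.
have qs : q = s ^+ 2 by rewrite sqr_sqrtr.
have l e : 0 < e -> 2 * f <= 2 * m * s + e * (m + s).
  move=> e0.
  have me : 0 < m + e by lra.
  have se : 0 < s + e by lra.
  apply: le_trans (h ((m + e) / (s + e)) _) _; first exact: divr_gt0.
  rewrite qs invf_div.
  have : (m + e) / (s + e) * s ^+ 2 <= (m + e) * s.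
    rewrite mulrAC ler_pdivrMr // -mulrA ler_pM2l // expr2 mulrDr lerDl.
    by rewrite mulr_ge0 // ltW.
  have : (s + e) / (m + e) * m ^+ 2 <= (s + e) * m.
    rewrite mulrAC ler_pdivrMr // -mulrA ler_pM2l // expr2 mulrDr lerDl.
    by rewrite mulr_ge0 // ltW.
  lra.
apply/ler_addgt0Pl => e e0.
have ms : 0 < m + s + 1 by lra.
have := l (e / (m + s + 1)) (divr_gt0 e0 ms).
have : e / (m + s + 1) * (m + s) <= e.
  by rewrite mulrAC ler_pdivrMr // ler_pM2l //; lra.
lra.
Qed.


(** The square root is continuous at [0] although not Lipschitz there, so errors
    of order [e] under the roots disappear in the limit. *)
Lemma sqrt_perturb_le (R : realType) (z x y a b k m : R) :
  0 <= x -> 0 <= y -> 0 <= a -> 0 <= b -> 0 <= k -> 0 <= m ->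
  (forall e : R, 0 < e -> e <= 2^-1 ->
    z <= a * Num.sqrt (x + e * k) + b * Num.sqrt (y + e * m)) ->
  z <= a * Num.sqrt x + b * Num.sqrt y.
Proof.
move=> x0 y0 a0 b0 k0 m0 h.
have split_sqrt (u v t : R) : 0 <= u -> 0 <= v -> 0 <= t ->
    Num.sqrt (v + u ^+ 2 * t) <= Num.sqrt v + u * Num.sqrt t.
  move=> u0 v0 t0.
  have s0 : 0 <= Num.sqrt v + u * Num.sqrt t.
    by rewrite addr_ge0 ?mulr_ge0 ?sqrtr_ge0.
  rewrite -[leRHS]ger0_norm // -sqrtr_sqr; apply: ler_wsqrtr.
  rewrite sqrrD exprMn !sqr_sqrtr // addrAC lerDl.
  by rewrite mulrn_wge0 // !mulr_ge0 ?sqrtr_ge0.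
apply/ler_addgt0Pl => e e0.
set c := a * Num.sqrt k + b * Num.sqrt m.
have c0 : 0 <= c by rewrite addr_ge0 // mulr_ge0 ?sqrtr_ge0.
have c1 : 0 < c + 1 by lra.
pose u := Num.min 2^-1 (e / (c + 1)).
have u0 : 0 < u by rewrite lt_min invr_gt0 ltr0n divr_gt0.
have u1 : u <= 2^-1 by rewrite ge_min lexx.
have uc : u * (c + 1) <= e.
  by rewrite -ler_pdivlMr // /u ge_min lexx orbT.
have u2 : u ^+ 2 <= 2^-1 by nra.
apply: le_trans (h (u ^+ 2) _ u2) _; first exact: exprn_gt0.
have h1 := ler_wpM2l a0 (split_sqrt u x k (ltW u0) x0 k0).
have h2 := ler_wpM2l b0 (split_sqrt u y m (ltW u0) y0 m0).
have : u * c <= e by rewrite (le_trans _ uc) // ler_pM2l // lerDl.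
rewrite /c; lra.
Qed.

(** * The Hahn-Banach theorem *)

Section HahnBanach.
Context (R : realType) (V : lmodType R).
Implicit Types (p q : V -> R) (x y : V).

Definition sublinear p : Prop :=
  (forall x y, p (x + y) <= p x + p y) /\
  (forall (t : R) x, 0 <= t -> p (t *: x) <= t * p x).

Lemma sublinear0 p : sublinear p -> p 0 = 0.
Proof.
move=> [pD pZ]; have := pD 0 0; have := pZ 0 0 (lexx _).
by rewrite scale0r addr0 mul0r; lra.
Qed.

Lemma sublinearZ p t x : sublinear p -> 0 <= t -> p (t *: x) = t * p x.
Proof.
move=> sp; rewrite le_eqVlt => /predU1P[<-|t0].
  by rewrite scale0r mul0r sublinear0.
apply/eqP; rewrite eq_le (sp.2 _ _ (ltW t0)) /= -ler_pdivlMl //.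
by rewrite -{1}[x]scale1r -(mulVf (lt0r_neq0 t0)) -scalerA sp.2 // invr_ge0 ltW.
Qed.

Lemma sublinear_geN p x : sublinear p -> - p (- x) <= p x.
Proof.
by move=> sp; have := sp.1 x (- x); rewrite subrr sublinear0 //; lra.
Qed.

(** The largest sublinear functional below [p] that is affine in the direction
    [y] is obtained by sliding along [y]; at a minimal [p] nothing changes, which
    is how minimality forces additivity. *)
Definition slide p y x : R :=
  inf [set r | exists2 t : R, 0 <= t & r = p (x + t *: y) - t * p y].

Lemma slide_ub p y x t : sublinear p -> 0 <= t ->
  slide p y x <= p (x + t *: y) - t * p y.
Proof.
move=> sp t0; apply: ge_inf; last by exists t.
exists (- p (- x)) => _ [s s0 ->].
have := sp.1 (x + s *: y) (- x).
rewrite addrAC subrr add0r (sublinearZ _ sp s0); lra.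
Qed.

Lemma slide_glb p y x r :
  (forall t, 0 <= t -> r <= p (x + t *: y) - t * p y) -> r <= slide p y x.
Proof.
move=> h; apply: lb_le_inf.
  by exists (p (x + 0 *: y) - 0 * p y), 0.
by move=> _ [t t0 ->]; exact: h.
Qed.

Lemma slide_le p y x : sublinear p -> slide p y x <= p x.
Proof.
by move=> sp; have := slide_ub y x sp (lexx 0); rewrite scale0r mul0r addr0 subr0.
Qed.

Lemma slide_sublinear p y : sublinear p -> sublinear (slide p y).
Proof.
move=> sp; split=> [x x'|t x].
  rewrite -lerBlDr; apply: slide_glb => t t0.
  rewrite lerBlDr -lerBlDl; apply: slide_glb => s s0.
  rewrite lerBlDl; apply: le_trans (slide_ub _ _ sp (addr_ge0 t0 s0)) _.
  have := sp.1 (x + t *: y) (x' + s *: y).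
  by rewrite addrACA -scalerDl; lra.
rewrite le_eqVlt => /predU1P[<-|t0].
  by rewrite scale0r mul0r -(sublinear0 sp); exact: slide_le.
rewrite -ler_pdivrMl //; apply: slide_glb => s s0.
rewrite ler_pdivrMl //.
apply: le_trans (slide_ub _ _ sp (mulr_ge0 (ltW t0) s0)) _.
by rewrite -scalerA -scalerDr (sublinearZ _ sp (ltW t0)) -mulrA mulrBr.
Qed.

(** Zorn's lemma applies to the pointwise order: the infimum of a chain is finite
    because [- p (- x)] is a common lower bound, and it stays subadditive because
    of any two members of the chain one is below the other. *)
Lemma minimal_sublinear p : sublinear p -> exists q,
  [/\ sublinear q, forall x, q x <= p x &
    forall q', sublinear q' -> (forall x, q' x <= q x) -> forall x, q x <= q' x].
Proof.
move=> sp.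
pose T := {q | sublinear q /\ forall x, q x <= p x}.
pose ge (q q' : T) := `[< forall x, sval q' x <= sval q x >].
have p0 : T by exists p.
have [| |A Atot|q qmin] := ZL_preorder p0 (R := ge).
- by move=> q; apply/asboolP.
- move=> q q' q'' /asboolP h /asboolP h'; apply/asboolP => x.
  exact: le_trans (h' x) (h x).
- have [->|/set0P[q0 Aq0]] := eqVneq A set0; first by exists p0.
  pose E x := [set r | exists2 q : T, A q & r = sval q x].
  have Elb x (q : T) : A q -> inf (E x) <= sval q x.
    move=> Aq; apply: ge_inf; last by exists q.
    exists (- p (- x)) => _ [q' _ ->]; have [sq' q'p] := svalP q'.
    by apply: le_trans (sublinear_geN x sq'); rewrite lerN2.
  have Eglb x r : (forall q : T, A q -> r <= sval q x) -> r <= inf (E x).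
    move=> h; apply: lb_le_inf; first by exists (sval q0 x), q0.
    by move=> _ [q Aq ->]; exact: h.
  have sE : sublinear (fun x => inf (E x)).
    split=> [x y|t x].
      rewrite -lerBlDr; apply: (Eglb) => q Aq.
      rewrite lerBlDr -lerBlDl; apply: (Eglb) => q' Aq'.
      rewrite lerBlDl.
      have [/asboolP le|/asboolP le] := Atot q q' Aq Aq'.
        apply: le_trans (Elb _ _ Aq') _; apply: le_trans ((svalP q').1.1 _ _) _.
        by rewrite lerD2r.
      apply: le_trans (Elb _ _ Aq) _; apply: le_trans ((svalP q).1.1 _ _) _.
      by rewrite lerD2l.
    rewrite le_eqVlt => /predU1P[<-|t0].
      rewrite scale0r mul0r; apply: le_trans (Elb _ _ Aq0) _.
      by rewrite (sublinear0 (svalP q0).1).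
    rewrite -ler_pdivrMl //; apply: (Eglb) => q Aq; rewrite ler_pdivrMl //.
    by apply: le_trans (Elb _ _ Aq) _; exact: (svalP q).1.2 (ltW t0).
  have Ep x : inf (E x) <= p x.
    by apply: le_trans (Elb _ _ Aq0) _; exact: (svalP q0).2.
  exists (exist _ (fun x => inf (E x)) (conj sE Ep)) => q Aq.
  by apply/asboolP => x; exact: Elb.
exists (sval q); have [sq qp] := svalP q; split=> // q' sq' q'q.
have q'p x : q' x <= p x by exact: le_trans (q'q x) (qp x).
by apply/asboolP; apply: (qmin (exist _ q' (conj sq' q'p))); apply/asboolP.
Qed.

(** Sliding [p] along [x0] first makes the value at [- x0] at most [- p x0].  A
    minimal sublinear functional below the result is linear, and it takes the
    value [p x0] at [x0]. *)
Theorem hahn_banach p x0 : sublinear p -> exists f : V -> R,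
  [/\ forall x y, f (x + y) = f x + f y, forall t x, f (t *: x) = t * f x,
      forall x, f x <= p x & f x0 = p x0].
Proof.
move=> sp; have s0 := slide_sublinear x0 sp.
have [f [sf fp fmin]] := minimal_sublinear s0.
have fD x y : f (x + y) = f x + f y.
  apply/eqP; rewrite eq_le sf.1 /=.
  have := fmin _ (slide_sublinear y sf) (fun x => slide_le y x sf) x.
  move/le_trans => /(_ _ (slide_ub y x sf ler01)).
  by rewrite scale1r mul1r lerBrDr.
have fN x : f (- x) = - f x.
  by have := fD x (- x); rewrite subrr sublinear0 //; lra.
have fle x : f x <= p x by exact: le_trans (fp x) (slide_le x0 x sp).
exists f; split=> // [t x|].
  have [t0|/ltW t0] := leP 0 t; first exact: sublinearZ.
  have := sublinearZ x sf (t := - t).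
  by rewrite oppr_ge0 scaleNr fN mulNr => /(_ t0) /oppr_inj.
apply/eqP; rewrite eq_le fle /=.
have := fp (- x0); move/le_trans => /(_ _ (slide_ub x0 (- x0) sp ler01)).
by rewrite scale1r addNr sublinear0 // mul1r sub0r fN lerN2.
Qed.

End HahnBanach.

(** * Square roots of hermitian elements *)

(** A unital C*-algebra, seen as a real algebra with a central square root [ii] of
    [-1], so that the real scalars of the order theory and of the Hahn-Banach
    theorem need no coercion.  The C*-identity is stated as the inequality
    that implies it together with submultiplicativity. *)
Record unital_cstar (R : realType) (U : algType R)
    (N : U -> R) (st : U -> U) (ii : U) : Prop := {
  uN0 : forall x, N x = 0 -> x = 0;
  uND : forall x y, N (x + y) <= N x + N y;
  uNZ : forall r x, N (r *: x) = `|r| * N x;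
  uNM : forall x y, N (x * y) <= N x * N y;
  uNst : forall x, N x ^+ 2 <= N (st x * x);
  ustK : involutive st;
  ustD : forall x y, st (x + y) = st x + st y;
  ustZ : forall r x, st (r *: x) = r *: st x;
  ustM : forall x y, st (x * y) = st y * st x;
  uiC : forall x, ii * x = x * ii;
  uii : ii * ii = -1;
  ust_i : st ii = - ii;
  uN_complete : forall u : nat -> U,
    (forall e, 0 < e -> exists n,
      forall m, (n <= m)%N -> N (u m - u n) <= e) ->
    exists l, forall e, 0 < e -> exists n,
      forall m, (n <= m)%N -> N (u m - l) <= e
}.

Section UnitalCStar.
Context (R : realType) (U : algType R) (N : U -> R) (st : U -> U) (ii : U).
Context (HU : unital_cstar N st ii).
Implicit Types (x y z w a b c h k s : U) (r t e : R) (B : set U).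

Let ND := uND HU.
Let NZ := uNZ HU.
Let NM := uNM HU.
Let stK := ustK HU.
Let stD := ustD HU.
Let stZ := ustZ HU.
Let stM := ustM HU.

Let N0 : N 0 = 0.
Proof. by rewrite -[0 in LHS](scale0r (0 : U)) NZ normr0 mul0r. Qed.

Let NN x : N (- x) = N x.
Proof. by rewrite -scaleN1r NZ normrN1 mul1r. Qed.

Let NB x y : N (x - y) = N (y - x).
Proof. by rewrite -NN opprB. Qed.

Let N_ge0 x : 0 <= N x.
Proof.
have := ND x (- x); rewrite subrr N0 NN; lra.
Qed.

Let N_triB x y : N (x - y) <= N x + N y.
Proof. by rewrite -[N y]NN; exact: ND. Qed.

Let N_eps x : (forall e, 0 < e -> N x <= e) -> x = 0.
Proof.
move=> hx; apply: (uN0 HU); apply/eqP; rewrite eq_le N_ge0 andbT.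
by apply/ler_addgt0Pl => e e0; rewrite addr0; exact: hx.
Qed.

Let stN x : st (- x) = - st x.
Proof. by rewrite -scaleN1r stZ scaleN1r. Qed.

Let st1 : st 1 = 1.
Proof. by have := stM (st 1) 1; rewrite stK !mulr1 stK => <-. Qed.

Let st0 : st 0 = 0.
Proof. by rewrite -[0 in LHS](scale0r (0 : U)) stZ scale0r. Qed.

(** The C*-identity and submultiplicativity give [|x| <= |x*|], and the involution
    exchanges the two sides. *)
Lemma N_star x : N (st x) = N x.
Proof.
have le y : N y <= N (st y).
  have h : N y ^+ 2 <= N (st y) * N y by apply: le_trans (uNst HU y) (NM _ _).
  have [->|ny] := eqVneq (N y) 0; first exact: N_ge0.
  have y0 : 0 < N y by rewrite lt_neqAle eq_sym ny N_ge0.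
  by rewrite -(ler_pM2r y0) -expr2.
by apply/eqP; rewrite eq_le le andbT -{2}(stK x) le.
Qed.

Lemma N_starM x : N (st x * x) = N x ^+ 2.
Proof.
apply/eqP; rewrite eq_le (uNst HU) andbT.
by apply: le_trans (NM _ _) _; rewrite N_star expr2.
Qed.

Let N1 : N 1 = 1.
Proof.
have h : N 1 = N 1 ^+ 2 by rewrite -N_starM st1 mulr1.
have n1 : N 1 != 0.
  by apply/eqP => /(uN0 HU) /eqP; rewrite (negPf (oner_neq0 _)).
by apply: (mulfI n1); rewrite -expr2 -h mulr1.
Qed.

Definition herm x := st x = x.

Let hermD x y : herm x -> herm y -> herm (x + y).
Proof. by rewrite /herm stD => -> ->. Qed.
Let hermN x : herm x -> herm (- x).
Proof. by rewrite /herm stN => ->. Qed.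
Let hermB x y : herm x -> herm y -> herm (x - y).
Proof. by move=> hx /hermN; apply: hermD. Qed.
Let hermZ r x : herm x -> herm (r *: x).
Proof. by rewrite /herm stZ => ->. Qed.
Let herm1 : herm 1. Proof. exact: st1. Qed.
Let herm0 : herm 0. Proof. exact: st0. Qed.
Let herm_sq x : herm x -> herm (x * x).
Proof. by rewrite /herm stM => ->. Qed.
Let hermM x y : herm x -> herm y -> x * y = y * x -> herm (x * y).
Proof. by rewrite /herm stM => -> -> ->. Qed.
Let herm_star x : herm (st x * x).
Proof. by rewrite /herm stM stK. Qed.

Let N_herm_sq x : herm x -> N (x * x) = N x ^+ 2.
Proof. by move=> hx; rewrite -N_starM hx. Qed.

(** Iterates towards the solution [g] of [g = (h + g^2) / 2], for which
    [(1 - g)^2 = 1 - h]. *)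
Fixpoint sqrt_iter (h : U) (n : nat) : U :=
  if n is m.+1 then 2^-1 *: (h + sqrt_iter h m * sqrt_iter h m) else 0.

(** The same iteration for the scalar [h = 1].  It dominates all others, because
    the iterates are polynomials in [h] with nonnegative coefficients. *)
Fixpoint sqrt_bound (n : nat) : R :=
  if n is m.+1 then 2^-1 * (1 + sqrt_bound m ^+ 2) else 0.

Lemma sqrt_bound01 n : 0 <= sqrt_bound n <= 1.
Proof.
elim: n => [|n /andP[a0 a1]] /=; first by rewrite lexx ler01.
by apply/andP; split; nra.
Qed.

Lemma sqrt_iter_norm h n : N h <= 1 -> N (sqrt_iter h n) <= sqrt_bound n.
Proof.
move=> h1; elim: n => [|n IH] /=; first by rewrite N0.
rewrite NZ ger0_norm ?invr_ge0 // ler_pM2l ?invr_gt0 //.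
apply: le_trans (ND _ _) _; apply: lerD => //.
apply: le_trans (NM _ _) _; rewrite expr2.
by exact: ler_pM.
Qed.

Lemma sqrt_iter_step h n : N h <= 1 ->
  N (sqrt_iter h n.+1 - sqrt_iter h n) <= sqrt_bound n.+1 - sqrt_bound n.
Proof.
move=> h1; elim: n => [|n IH].
  rewrite /= !(mulr0, addr0, subr0, expr0n) /= NZ ger0_norm ?invr_ge0 //.
  rewrite ler_pM2l ?invr_gt0 // !addr0 //.
set g1 := sqrt_iter h n.+1 in IH *; set g0 := sqrt_iter h n in IH *.
set b1 := sqrt_bound n.+1 in IH *; set b0 := sqrt_bound n in IH *.
have -> : sqrt_iter h n.+2 - g1 = 2^-1 *: (g1 * (g1 - g0) + (g1 - g0) * g0).
  rewrite {2}/g1 /= -/g0 -/g1 -scalerBr; congr (_ *: _).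
  by rewrite mulrBr mulrBl addrA subrK opprD addrACA subrr add0r.
have -> : sqrt_bound n.+2 - b1 = 2^-1 * (b1 * (b1 - b0) + (b1 - b0) * b0).
  by rewrite /b1 /= -/b0; field.
rewrite NZ ger0_norm ?invr_ge0 // ler_pM2l ?invr_gt0 //.
apply: le_trans (ND _ _) _; apply: lerD.
  apply: le_trans (NM _ _) _.
  by apply: ler_pM => //; exact: sqrt_iter_norm.
apply: le_trans (NM _ _) _.
by apply: ler_pM => //; exact: sqrt_iter_norm.
Qed.

Lemma sqrt_iter_cauchy h n m : N h <= 1 -> (n <= m)%N ->
  N (sqrt_iter h m - sqrt_iter h n) <= sqrt_bound m - sqrt_bound n.
Proof.
move=> h1 /subnK <-; elim: (m - n)%N => [|k IH].
  by rewrite add0n !subrr N0.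
rewrite addSn -(subrKA (sqrt_iter h (k + n))) -(subrKA (sqrt_bound (k + n))).
by apply: le_trans (ND _ _) _; apply: lerD => //; exact: sqrt_iter_step.
Qed.

(** The iterates form a Cauchy sequence because their increments are dominated by
    those of a bounded monotone real sequence; this covers the boundary case
    [|h| = 1], where the fixed-point map is not a contraction. *)
Lemma sqrt_one_sub h : herm h -> N h <= 1 -> exists s,
  [/\ herm s, s * s = 1 - h, N (1 - s) <= 1 &
      forall y, y * h = h * y -> y * s = s * y].
Proof.
move=> hh h1.
have [e e0|l hl] := uN_complete HU (u := sqrt_iter h).
  have hs : has_sup (range sqrt_bound).
    split; first by exists (sqrt_bound 0), 0%N.
    by exists 1 => _ [n _ <-]; have /andP[] := sqrt_bound01 n.
  have [_ [n _ <-] hn] := sup_adherent e0 hs.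
  exists n => m nm; apply: le_trans (sqrt_iter_cauchy h1 nm) _.
  have : sqrt_bound m <= sup (range sqrt_bound).
    by apply: ub_le_sup; [exact: hs.2 | exists m].
  lra.
have near e : 0 < e -> exists2 n,
    N (sqrt_iter h n - l) <= e & N (sqrt_iter h n.+1 - l) <= e.
  by move=> e0; have [n hn] := hl e e0; exists n; apply: hn.
have gn n : N (sqrt_iter h n) <= 1.
  by apply: le_trans (sqrt_iter_norm n h1) _; have /andP[] := sqrt_bound01 n.
have l1 : N l <= 1.
  apply/ler_addgt0Pl => e e0; have [n hn _] := near e e0.
  rewrite -(subKr (sqrt_iter h n) l); apply: le_trans (N_triB _ _) _.
  by rewrite addrC; apply: lerD.
have hl_fix : l = 2^-1 *: (h + l * l).
  apply/eqP; rewrite -subr_eq0; apply/eqP; apply: N_eps => e e0.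
  have e20 : 0 < e / 2 by rewrite divr_gt0.
  have [n hn hn1] := near _ e20.
  rewrite -(subrKA (sqrt_iter h n.+1)); apply: le_trans (ND _ _) _.
  rewrite [e]splitr; apply: lerD; first by rewrite NB.
  rewrite /= -scalerBr NZ ger0_norm ?invr_ge0 // opprD addrACA subrr add0r.
  set g := sqrt_iter h n in hn *.
  have -> : g * g - l * l = g * (g - l) + (g - l) * l.
    by rewrite mulrBr mulrBl addrA subrK.
  have := ND (g * (g - l)) ((g - l) * l).
  have : N (g * (g - l)) <= 1 * (e / 2).
    by apply: le_trans (NM _ _) _; apply: ler_pM => //; apply: gn.
  have : N ((g - l) * l) <= (e / 2) * 1.
    by apply: le_trans (NM _ _) _; apply: ler_pM => //; apply: gn.
  lra.
have comm y : y * h = h * y -> y * l = l * y.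
  move=> yh; apply/eqP; rewrite -subr_eq0; apply/eqP; apply: N_eps => e e0.
  have gy n : y * sqrt_iter h n = sqrt_iter h n * y.
    elim: n => [|n IH] /=; first by rewrite mulr0 mul0r.
    by rewrite -scalerAl -scalerAr mulrDl mulrDr yh mulrA IH -!mulrA IH.
  have d0 : 0 < e / (2 * N y + 1).
    by rewrite divr_gt0 //; have := N_ge0 y; lra.
  have [n hn _] := near _ d0.
  set g := sqrt_iter h n in hn.
  have -> : y * l - l * y = (g - l) * y - y * (g - l).
    by rewrite mulrBl mulrBr gy -/g opprB [RHS]addrC addrA subrK.
  apply: le_trans (N_triB _ _) _.
  have a1 := NM (g - l) y; have a2 := NM y (g - l).
  have a3 : N (g - l) * (2 * N y + 1) <= e.
    by rewrite -ler_pdivlMr //; have := N_ge0 y; lra.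
  have := N_ge0 y; have := N_ge0 (g - l); nra.
have herml : herm l.
  apply/eqP; rewrite -subr_eq0; apply/eqP; apply: N_eps => e e0.
  have hg n : herm (sqrt_iter h n).
    elim: n => [|n IH] /=; first exact: herm0.
    by apply: hermZ; apply: hermD => //; apply: herm_sq.
  have e20 : 0 < e / 2 by rewrite divr_gt0.
  have [n hn _] := near _ e20.
  rewrite -(subrKA (sqrt_iter h n)); apply: le_trans (ND _ _) _.
  rewrite [e]splitr; apply: lerD => //.
  by rewrite -[X in _ - X]hg -stN -stD N_star NB.
exists (1 - l); split.
- exact: hermB.
- have l2 : l * l = l + l - h.
    have : 2 *: l = h + l * l.
      by rewrite {1}hl_fix scalerA mulfV ?scale1r // pnatr_eq0.
    by rewrite scaler_nat mulr2n => ->; rewrite addrC addKr.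
  rewrite mulrBl mul1r mulrBr mulr1 l2.
  by rewrite opprB [_ - h - l]addrAC addrK addrA subrK.
- by rewrite subKr.
- by move=> y yh; rewrite mulrBl mulrBr mulr1 mul1r comm.
Qed.

(** * Positive elements *)

Let iC := uiC HU.

Let i_sq a : ii * a * (ii * a) = - (a * a).
Proof. by rewrite -mulrA (mulrA a) -iC !mulrA (uii HU) mulN1r mulNr. Qed.

(** Nonnegativity of the spectrum, expressed by the norm alone; in this form the
    stability under sums is the triangle inequality. *)
Definition pos h := herm h /\ exists2 t, 0 <= t & N (t%:A - h) <= t.

Lemma posD h k : pos h -> pos k -> pos (h + k).
Proof.
move=> [hh [t t0 ht]] [hk [s s0 hs]]; split; first exact: hermD.
exists (t + s); first exact: addr_ge0.
by rewrite scalerDl opprD addrACA; apply: le_trans (ND _ _) _; exact: lerD.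
Qed.

Lemma posZ r h : 0 <= r -> pos h -> pos (r *: h).
Proof.
move=> r0 [hh [t t0 ht]]; split; first exact: hermZ.
exists (r * t); first exact: mulr_ge0.
by rewrite -scalerA -scalerBr NZ ger0_norm // ler_wpM2l.
Qed.

Lemma pos_scalar t : 0 <= t -> pos t%:A.
Proof.
by move=> t0; split; [exact: hermZ | exists t => //; rewrite subrr N0].
Qed.

Lemma pos_sub_norm h t : herm h -> N h <= t -> pos (t%:A - h).
Proof.
move=> hh ht; split; first by apply: hermB => //; apply: hermZ.
by exists t; [exact: le_trans ht | rewrite subKr].
Qed.

(** If [|t - h| <= t] then [h / t = 1 - (1 - h / t)] with [|1 - h / t| <= 1]. *)
Lemma pos_sqrt h : pos h -> exists s,
  [/\ herm s, s * s = h, pos s & forall y, y * h = h * y -> y * s = s * y].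
Proof.
move=> [hh [t]]; rewrite le_eqVlt => /predU1P[<-|t0] ht.
  have -> : h = 0.
    apply: (uN0 HU); apply/eqP.
    by rewrite eq_le N_ge0 andbT -NN -[- h]add0r -(scale0r 1).
  exists 0; split; rewrite ?mulr0 //.
  by rewrite -(scale0r 1); exact: pos_scalar.
have tN : t != 0 by rewrite gt_eqF.
have hk : herm (1 - t^-1 *: h) by apply: hermB => //; apply: hermZ.
have [|s [hs ss s1 sC]] := sqrt_one_sub hk.
  have -> : 1 - t^-1 *: h = t^-1 *: (t%:A - h).
    by rewrite scalerBr scalerA mulVf // scale1r.
  by rewrite NZ gtr0_norm ?invr_gt0 // mulrC ler_pdivrMr // mul1r.
exists (Num.sqrt t *: s); split.
- exact: hermZ.
- rewrite -scalerAl -scalerAr scalerA -expr2 sqr_sqrtr ?ltW // ss subKr.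
  by rewrite scalerA mulfV // scale1r.
- apply: posZ; first exact: sqrtr_ge0.
  by split => //; exists 1; rewrite // scale1r.
- move=> y yh; rewrite -scalerAl -scalerAr sC // mulrBl mulrBr mulr1 mul1r.
  by rewrite -scalerAl -scalerAr yh.
Qed.

(** The element [u = s + ii r] satisfies [u* u = s^2 + r^2 = t], hence
    [|u|^2 = t], and [s] is the average of [u] and [u*]. *)
Lemma norm_sq_le_sum_sq (s r : U) t : herm s -> herm r -> s * r = r * s ->
  0 <= t -> s * s + r * r = t%:A -> N s ^+ 2 <= t.
Proof.
move=> hs hr sr t0 srt.
pose u := s + ii * r.
have su : st u = s - ii * r.
  by rewrite /u stD stM hs hr (ust_i HU) mulrN iC.
have Nu : N u ^+ 2 = t.
  rewrite -N_starM su /u mulrDr !mulrBl.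
  rewrite i_sq.
  have -> : s * (ii * r) = ii * r * s by rewrite mulrA -iC -!mulrA sr.
  by rewrite opprK addrA subrK srt NZ N1 mulr1 ger0_norm.
rewrite -Nu ler_sqr ?nnegrE //.
have -> : s = 2^-1 *: (u + st u).
  rewrite su /u addrACA subrr addr0 scalerDr -scalerDl -[LHS]scale1r.
  by congr (_ *: _); field.
rewrite NZ ger0_norm ?invr_ge0 //.
have := ND u (st u); rewrite N_star; lra.
Qed.

(** After scaling, [1 - s^2 = r^2] with [r] hermitian and commuting with [s], so
    [|1 - s^2| = |r|^2 <= 1]. *)
Lemma pos_sq s : herm s -> pos (s * s).
Proof.
move=> hs; have [s0|sN] := eqVneq (N s) 0.
  by rewrite (uN0 HU s0) mulr0 -(scale0r 1); exact: pos_scalar.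
have m0 : 0 < N s ^+ 2 by rewrite exprn_gt0 // lt_neqAle eq_sym sN /=.
have hx : herm ((N s ^+ 2)^-1 *: (s * s)) by apply: hermZ; apply: herm_sq.
have [|r [hr rr _ rC]] := sqrt_one_sub hx.
  by rewrite NZ gtr0_norm ?invr_gt0 // N_herm_sq // mulVf // gt_eqF.
have rr' : (N s *: r) * (N s *: r) = (N s ^+ 2)%:A - s * s.
  rewrite -scalerAl -scalerAr scalerA -expr2 rr scalerBr scalerA mulfV ?scale1r //.
  by rewrite gt_eqF.
split; first exact: herm_sq.
exists (N s ^+ 2); first exact: ltW.
rewrite -rr' N_herm_sq; last exact: hermZ.
apply: (@norm_sq_le_sum_sq _ s) => //; first exact: hermZ.
- rewrite -scalerAl -scalerAr rC // -scalerAl -scalerAr mulrA //.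
- exact: ltW.
- by rewrite rr' subrK.
Qed.

(** With [h = s^2] and [t - h = r^2] the roots commute and [s^2 + r^2 = t]. *)
Lemma norm_le_pos h t : 0 <= t -> pos h -> pos (t%:A - h) -> N h <= t.
Proof.
move=> t0 /pos_sqrt[s [hs ss _ _]] /pos_sqrt[r [hr rr _ rC]].
rewrite -ss N_herm_sq //; apply: (norm_sq_le_sum_sq hs hr) => //.
  by apply: rC; rewrite mulrBr mulrBl -scalerAl -scalerAr mul1r mulr1 -ss mulrA.
by rewrite ss rr addrC subrK.
Qed.

Lemma pos_anti h : pos h -> pos (- h) -> h = 0.
Proof.
move=> h1 h2; apply: (uN0 HU); apply/eqP; rewrite eq_le N_ge0 andbT.
by apply: norm_le_pos => //; rewrite scale0r add0r.
Qed.

(** For [c = p + ii q] with [p], [q] hermitian the sum is [2 (p^2 + q^2)]. *)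
Lemma pos_star_sum c : pos (c * st c + st c * c).
Proof.
pose p := 2^-1 *: (c + st c); pose q := 2^-1 *: (ii * (st c - c)).
have hp : herm p by apply: hermZ; rewrite /herm stD stK addrC.
have hq : herm q.
  apply: hermZ; rewrite /herm stM stD stN stK (ust_i HU) mulrN -iC.
  by rewrite -mulrN opprB.
have -> : c * st c + st c * c = 2 *: (p * p + q * q).
  have -> : q * q = (2^-1 * 2^-1) *: - ((st c - c) * (st c - c)).
    rewrite /q -scalerAl -scalerAr scalerA; congr (_ *: _).
    exact: i_sq.
  rewrite /p -scalerAl -scalerAr scalerA -scalerDr scalerA.
  rewrite !(mulrDl, mulrDr) !mulrN !mulNr.
  set x := c * c; set y := c * st c; set z := st c * c; set w := st c * st c.
  have -> : x + y + (z + w) - (w - z + (- y - - x)) = 2 *: (y + z).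
    rewrite scaler_nat mulr2n !opprD !opprK.
    rewrite [x + y]addrC [y + x + _]addrACA [- w + z]addrC [z - w + _]addrACA.
    by rewrite -opprD [z + y]addrC [x + w]addrC [LHS]addrACA subrr addr0.
  by rewrite scalerA -[LHS]scale1r; congr (_ *: _); field.
by apply: posZ => //; apply: posD; apply: pos_sq.
Qed.

(** The Kelley-Vaught theorem.  Let [h = b* b], [k = (h^2)^(1/2)], [v = k - h] and
    [c = b v].  Then [c* c = v h v = - k v^2 = - z^2] with [z = k^(1/2) v], and
    [pos_star_sum] makes [c c*] positive, say [c c* = y^2].  Applied to [c z]
    instead of [c], the same sum is [- (y^4 + z^4)]; so [z = 0], which
    unwinds to [c = 0], [v = 0] and [h = k]. *)
Theorem pos_star_mul b : pos (st b * b).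
Proof.
set h := st b * b.
have hh : herm h by exact: herm_star.
have [k [hk kk kpos kC]] := pos_sqrt (pos_sq hh).
have hkC : h * k = k * h by apply: kC; rewrite mulrA.
have [r [hr rr _ rC]] := pos_sqrt kpos.
pose v := k - h.
have hv : herm v by exact: hermB.
have vr : v * r = r * v by apply: rC; rewrite /v mulrBl mulrBr hkC.
have hvE : h * v = - (k * v) by rewrite /v !mulrBr hkC kk opprB.
have vk : v * k = k * v by rewrite /v mulrBl mulrBr hkC.
pose c := b * v; pose z := r * v.
have hz : herm z by exact: hermM.
have zz : st c * c = - (z * z).
  rewrite /c stM hv mulrA -(mulrA v) -/h -mulrA hvE mulrN mulrA vk.
  by rewrite /z -mulrA (mulrA v) vr !mulrA rr.
have posc : pos (c * st c).
  rewrite -[c * st c](addrK (st c * c)) {2}zz opprK.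
  by apply: posD; [exact: pos_star_sum | exact: pos_sq].
have [y [hy yy _ _]] := pos_sqrt posc.
have z0 : z = 0.
  have hz2 := herm_sq hz; have hy2 := herm_sq hy.
  (* [- z^4] is the positive element [- (y^4 + z^4)] plus [y^4]. *)
  have z4 : z * z * (z * z) = 0.
    apply: pos_anti; first exact: pos_sq.
    have := posD (pos_star_sum (c * z)) (pos_sq hy2).
    have -> : c * z * st (c * z) = - (y * y * (y * y)).
      rewrite stM hz mulrA -(mulrA c) -[z * z]opprK -zz yy.
      by rewrite mulrN mulNr !mulrA.
    have -> : st (c * z) * (c * z) = - (z * z * (z * z)).
      by rewrite stM hz mulrA -(mulrA z) zz mulrN mulNr !mulrA.
    by rewrite addrAC addNr add0r.
  apply: (uN0 HU); apply/eqP.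
  by have /eqP := N_herm_sq hz2; rewrite z4 N0 eq_sym sqrf_eq0 N_herm_sq // sqrf_eq0.
have c0 : c = 0.
  apply: (uN0 HU); apply/eqP.
  by have /eqP := N_starM c; rewrite zz z0 mulr0 oppr0 N0 eq_sym sqrf_eq0.
have hv0 : h * v = 0 by rewrite /h -mulrA -/c c0 mulr0.
have v0 : v = 0.
  apply: (uN0 HU); apply/eqP; rewrite -sqrf_eq0 -N_herm_sq //.
  rewrite {1}/v mulrBl hv0 subr0 -[k * v]opprK -hvE hv0 oppr0 N0 //.
by move/eqP: v0; rewrite subr_eq0 => /eqP <-.
Qed.

Lemma pos_conj h x : pos h -> pos (st x * h * x).
Proof.
move=> /pos_sqrt[s [hs <- _ _]].
by have := pos_star_mul (s * x); rewrite stM hs !mulrA.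
Qed.

Lemma pos_norm_sub_starM y x :
  pos ((N y ^+ 2) *: (st x * x) - st (y * x) * (y * x)).
Proof.
have h : pos ((N y ^+ 2)%:A - st y * y).
  by apply: pos_sub_norm; [exact: herm_star | rewrite N_starM].
have := pos_conj x h.
by rewrite mulrBr mulrBl -scalerAr mulr1 -scalerAl stM !mulrA.
Qed.

(** [w* w <= r k <= r |k|], and for positive elements an upper bound by a scalar
    bounds the norm. *)
Lemma norm_le_dominated w k r : 0 <= r -> herm k -> pos (r *: k - st w * w) ->
  N w ^+ 2 <= r * N k.
Proof.
move=> r0 hk hw; rewrite -N_starM; apply: norm_le_pos.
- exact: mulr_ge0.
- exact: pos_star_mul.
- have := posD (posZ r0 (pos_sub_norm hk (lexx (N k)))) hw.
  by rewrite scalerBr scalerA addrA subrK.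
Qed.

(** * The separating functional *)

(** [w* w <= r k], arranged so that the triples [(w, k, r)] visibly form a
    convex cone, the epigraph of the operator perspective of [w |-> w* w]. *)
Definition dominated w k r :=
  [/\ 0 < r, herm k & pos (k - r^-1 *: (st w * w))].

(** Joint convexity of [w* w / r]: the defect is a positive multiple of
    [z* z] with [z = r' w - r w']. *)
Lemma dominatedD w w' k k' r r' : dominated w k r -> dominated w' k' r' ->
  dominated (w + w') (k + k') (r + r').
Proof.
move=> [r0 hk wk] [r0' hk' wk']; split; [exact: addr_gt0 | exact: hermD |].
have s0 : 0 < r + r' by exact: addr_gt0.
pose z := r' *: w - r *: w'.
pose m := r^-1 * r'^-1 * (r + r')^-1.
have m0 : 0 <= m by rewrite !mulr_ge0 // invr_ge0 ltW.
have -> : k + k' - (r + r')^-1 *: (st (w + w') * (w + w')) =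
    (k - r^-1 *: (st w * w)) + (k' - r'^-1 *: (st w' * w')) + m *: (st z * z).
  rewrite [in RHS]addrACA -[RHS]addrA; congr (_ + _).
  rewrite /z !stD stN !stZ !(mulrDl, mulrDr, mulrN, mulNr) opprK.
  rewrite -!(scalerAl, scalerAr) !scalerA.
  set x := st w * w; set y := st w * w'; set y' := st w' * w; set z' := st w' * w'.
  have -> : r^-1 = (r + r')^-1 + m * (r' * r') by rewrite /m; field; rewrite !gt_eqF.
  have -> : r'^-1 = (r + r')^-1 + m * (r * r) by rewrite /m; field; rewrite !gt_eqF.
  have E : m * (r' * r) = (r + r')^-1 by rewrite /m; field; rewrite !gt_eqF.
  have E' : m * (r * r') = (r + r')^-1 by rewrite -E (mulrC r).
  rewrite !(scalerDr, scalerDl, scalerN, scalerA) E E' !opprD.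
  by zmod_cancel.
apply: posD; first exact: posD.
by apply: posZ => //; exact: pos_star_mul.
Qed.

Lemma dominatedZ t w k r : 0 < t -> dominated w k r ->
  dominated (t *: w) (t *: k) (t * r).
Proof.
move=> t0 [r0 hk wk]; split; [exact: mulr_gt0 | exact: hermZ |].
have -> : (t * r)^-1 *: (st (t *: w) * (t *: w)) = t *: (r^-1 *: (st w * w)).
  rewrite stZ -scalerAl -scalerAr !scalerA; congr (_ *: _).
  by field; rewrite !gt_eqF.
by rewrite -scalerBr; apply: posZ => //; exact: ltW.
Qed.

Lemma dominated_mul y x r : N y ^+ 2 < r -> dominated (y * x) (st x * x) r.
Proof.
move=> yr; have r0 : 0 < r by exact: le_lt_trans (sqr_ge0 _) yr.
split=> //.
have -> : st x * x - r^-1 *: (st (y * x) * (y * x)) =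
    r^-1 *: ((r - N y ^+ 2) *: (st x * x) +
             ((N y ^+ 2) *: (st x * x) - st (y * x) * (y * x))).
  by rewrite addrA -scalerDl subrK scalerBr scalerA mulVf ?gt_eqF // scale1r.
apply: posZ; first by rewrite invr_ge0 ltW.
apply: posD; last exact: pos_norm_sub_starM.
by apply: posZ; [rewrite subr_ge0 ltW | exact: pos_star_mul].
Qed.

Lemma dominated0 r : 0 < r -> dominated 0 0 r.
Proof.
by move=> r0; have := @dominated_mul 0 0 r; rewrite st0 mulr0 N0 expr0n; exact.
Qed.

(** [|w|^2 <= r |k|], and the geometric mean is at most the arithmetic mean. *)
Lemma dominated_norm w k r : dominated w k r -> 2 * N w <= N k + r.
Proof.
move=> [r0 hk wk].
have : N w ^+ 2 <= r * N k.
  apply: norm_le_dominated hk _; first exact: ltW.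
  rewrite (_ : _ - _ = r *: (k - r^-1 *: (st w * w))); last first.
    by rewrite scalerBr scalerA mulfV ?gt_eqF // scale1r.
  by apply: posZ => //; exact: ltW.
have := N_ge0 w; have := N_ge0 k; have := sqr_ge0 (N k - r); nra.
Qed.

Section Subspace.
Context (B : set U) (B0 : B 0) (BD : forall x y, B x -> B y -> B (x + y))
  (BZ : forall r x, B x -> B (r *: x)).

Let BN x : B x -> B (- x).
Proof. by rewrite -scaleN1r; exact: BZ. Qed.

Let BB x y : B x -> B y -> B (x - y).
Proof. by move=> bx /BN; exact: BD. Qed.

(** The first component will carry the functional vanishing on [B] and the second
    one the positive functional. *)
Definition gauge (v : U * U) : R :=
  inf [set t | exists w k r,
    [/\ dominated w k r, B (w - v.1) & t = 2^-1 * (N (v.2 + k) + r)]].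

Lemma gauge_ub v w k r : dominated w k r -> B (w - v.1) ->
  gauge v <= 2^-1 * (N (v.2 + k) + r).
Proof.
move=> wk Bw; apply: ge_inf; last by exists w, k, r.
exists 0 => _ [w' [k' [r' [[r0 _ _] _ ->]]]].
by rewrite mulr_ge0 ?invr_ge0 // addr_ge0 // ltW.
Qed.

Lemma gauge_glb v m :
  (forall w k r, dominated w k r -> B (w - v.1) -> m <= 2^-1 * (N (v.2 + k) + r)) ->
  m <= gauge v.
Proof.
move=> h; apply: lb_le_inf; last by move=> _ [w [k [r [wk Bw ->]]]]; exact: (h w k r).
exists (2^-1 * (N (v.2 + st 1 * 1) + (N v.1 ^+ 2 + 1))).
exists (v.1 * 1), (st 1 * 1), (N v.1 ^+ 2 + 1); split=> //.
  by apply: dominated_mul; rewrite ltrDl.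
by rewrite mulr1 subrr.
Qed.

Lemma gauge_sublinear : sublinear gauge.
Proof.
split=> [x y|t x].
  rewrite -lerBlDr; apply: gauge_glb => w k r wk Bw.
  rewrite lerBlDr -lerBlDl; apply: gauge_glb => w' k' r' wk' Bw'.
  rewrite lerBlDl; apply: le_trans (gauge_ub (dominatedD wk wk') _) _.
    by rewrite /= opprD addrACA; exact: BD.
  rewrite -mulrDr ler_pM2l ?invr_gt0 // /= addrACA [leRHS]addrACA lerD2r.
  exact: ND.
rewrite le_eqVlt => /predU1P[<-|t0].
  rewrite mul0r scale0r; apply/ler_addgt0Pl => e e0; rewrite addr0.
  apply: le_trans (gauge_ub (dominated0 e0) _) _; rewrite /= ?subr0 //.
  by rewrite addr0 N0 add0r; lra.
rewrite -ler_pdivrMl //; apply: gauge_glb => w k r wk Bw; rewrite ler_pdivrMl //.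
apply: le_trans (gauge_ub (dominatedZ t0 wk) _) _.
  by rewrite /= -scalerBr; exact: BZ.
by rewrite /= -scalerDr NZ gtr0_norm // mulrCA -mulrDr.
Qed.

Lemma gauge_ge_dist a m : (forall b, B b -> m <= N (a - b)) -> m <= gauge (a, 0).
Proof.
move=> h; apply: gauge_glb => w k r wk /= /BN Bw.
have := h _ Bw; rewrite opprB subKr add0r.
have := dominated_norm wk; lra.
Qed.

(** The functionals are the two components of a linear functional below [gauge]
    that agrees with it at [(a, 0)].  Comparing with the gauge at
    [(y x, - x* x)] gives [2 f (y x) <= phi (x* x) + |y|^2]; rescaling [y] and [x]
    in opposite directions turns this into a product bound. *)
Theorem separating_functional a m : (forall b, B b -> m <= N (a - b)) ->
  exists f phi : U -> R,
  [/\ (forall x y, f (x + y) = f x + f y) /\ (forall t x, f (t *: x) = t * f x),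
      (forall x y, phi (x + y) = phi x + phi y) /\
        (forall t x, phi (t *: x) = t * phi x),
      (forall h, phi h <= N h) /\ (forall x, 0 <= phi (st x * x)),
      (forall b, B b -> f b = 0) /\ m <= f a &
      forall y x, f (y * x) <= N y * Num.sqrt (phi (st x * x))].
Proof.
move=> ham.
have [l [lD lZ lP lam]] := hahn_banach (a, 0) gauge_sublinear.
have lD' x x' y y' : l (x + x', y + y') = l (x, y) + l (x', y').
  exact: (lD (_, _) (_, _)).
have lZ' t x y : l (t *: x, t *: y) = t * l (x, y) by exact: (lZ t (_, _)).
exists (fun x => l (x, 0)), (fun h => 2 * l (0, h)).
have fD x y : l (x + y, 0) = l (x, 0) + l (y, 0) by rewrite -lD' addr0.
have fZ t x : l (t *: x, 0) = t * l (x, 0) by rewrite -lZ' scaler0.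
have pD x y : l (0, x + y) = l (0, x) + l (0, y) by rewrite -lD' addr0.
have pZ t x : l (0, t *: x) = t * l (0, x) by rewrite -lZ' scaler0.
have key y x : 2 * l (y * x, 0) <= 2 * l (0, st x * x) + N y ^+ 2.
  apply/ler_addgt0Pl => e e0.
  have ye : N y ^+ 2 < N y ^+ 2 + e by rewrite ltrDl.
  have := le_trans (lP (y * x, - (st x * x))) (gauge_ub (dominated_mul x ye) _).
  rewrite /= subrr addNr N0 -{1}[y * x]addr0 -[- (st x * x)]add0r lD'.
  have -> : l (0, - (st x * x)) = - l (0, st x * x).
    by rewrite -scaleN1r pZ mulN1r.
  move=> /(_ B0); lra.
have pos_phi x : 0 <= 2 * l (0, st x * x).
  have := key 0 x; rewrite mul0r N0 expr0n addr0.
  by rewrite (_ : l (0, 0) = 0) ?mulr0 // -(scale0r (0 : U)) lZ' mul0r.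
split.
- by split.
- by split=> [x y|t x]; rewrite ?pD ?pZ; [rewrite mulrDr | rewrite mulrCA].
- split=> // h; apply/ler_addgt0Pl => e e0.
  have := le_trans (lP (0, h)) (gauge_ub (dominated0 e0) _).
  by rewrite /= subr0 addr0 => /(_ B0); lra.
- split; last by rewrite lam; exact: gauge_ge_dist.
  have fB b : B b -> l (b, 0) <= 0.
    move=> Bb; apply/ler_addgt0Pl => e e0.
    have := le_trans (lP (b, 0)) (gauge_ub (dominated0 e0) _).
    by rewrite /= sub0r !addr0 N0 => /(_ (BN Bb)); lra.
  move=> b Bb; have := fB _ Bb; have := fB _ (BN Bb).
  rewrite -scaleN1r fZ; lra.
- move=> y x; apply: le_mul_sqrt => // s s0.
  have u0 : 0 < Num.sqrt s by rewrite sqrtr_gt0.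
  have := key ((Num.sqrt s)^-1 *: y) (Num.sqrt s *: x).
  rewrite -scalerAl -scalerAr scalerA mulVf ?gt_eqF // scale1r.
  rewrite stZ -scalerAl -scalerAr scalerA pZ NZ gtr0_norm ?invr_gt0 //.
  by rewrite exprMn exprVn -expr2 (sqr_sqrtr (ltW s0)) [2 * (s * _)]mulrCA.
Qed.

(** * Near-projections and the two norm inequalities *)

Section NearProjection.
Context (phi : U -> R) (phiD : forall x y, phi (x + y) = phi x + phi y)
  (phiZ : forall t x, phi (t *: x) = t * phi x)
  (phi_le : forall h, phi h <= N h)
  (phi_ge0 : forall x, 0 <= phi (st x * x)).

Let q x := phi (st x * x).
Let ip x y := phi (st x * y + st y * x).

Let qD x y t : q (x + t *: y) = q x + t * ip x y + t ^+ 2 * q y.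
Proof.
have -> : q (x + t *: y) =
    phi (st x * x + t *: (st x * y + st y * x) + t ^+ 2 *: (st y * y)).
  rewrite /q stD stZ expr2; congr phi.
  rewrite mulrDl !mulrDr -[in LHS]scalerAr -2![in LHS]scalerAl -[in LHS]scalerAr.
  by rewrite scalerA scalerDr !addrA.
by rewrite !phiD !phiZ.
Qed.

Let q_ge0 x : 0 <= q x.
Proof. exact: phi_ge0. Qed.

Let q_le x : q x <= N x ^+ 2.
Proof. by rewrite -N_starM; exact: phi_le. Qed.

Let qM y x : q (y * x) <= N y ^+ 2 * q x.
Proof.
have [s [hs ss _ _]] := pos_sqrt (pos_norm_sub_starM y x).
have := phi_ge0 s; rewrite hs ss phiD phiZ -scaleN1r phiZ /q; lra.
Qed.

(** A near-minimizer [d] of the distance from [x] to [B] in the seminorm of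
    [phi]; moving [d] by [e b] or [- e b] shows that [x - d] is nearly orthogonal
    to [b]. *)
Lemma near_projection x e : 0 < e -> e <= 2^-1 -> exists d,
  [/\ B d, forall b, B b -> q (x - d) <= q (x - b) + e,
      forall b, B b -> `|ip (x - d) b| <= e * (1 + q b) &
      q d <= 2 * q x + 1].
Proof.
move=> e0 e1; set E := [set q (x - b) | b in B].
have E0 : E !=set0 by exists (q (x - 0)), 0.
have Elb : has_lbound E by exists 0 => _ [b _ <-]; exact: q_ge0.
have [|_ [d Bd <-] hd] := @inf_lt _ E (inf E + e ^+ 2) E0.
  by rewrite ltrDl exprn_gt0.
have hb b : B b -> q (x - d) - e ^+ 2 <= q (x - b).
  by move=> Bb; have : inf E <= q (x - b) by [apply: ge_inf => //; exists b]; lra.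
have hip b : B b -> `|ip (x - d) b| <= e * (1 + q b).
  move=> Bb.
  have ht t : - (t * ip (x - d) b) <= e ^+ 2 + t ^+ 2 * q b.
    have := hb _ (BB Bd (BZ t Bb)).
    by rewrite opprB addrCA addrC qD; lra.
  have he := ht e; have hN := ht (- e).
  rewrite ler_norml -(ler_pM2l e0) -[X in _ && X](ler_pM2l e0).
  by apply/andP; split; nra.
exists d; split=> // [b Bb|]; first by have := hb b Bb; nra.
have := hip d Bd; rewrite ler_norml => /andP[h1 _].
have := qD (x - d) d 1; rewrite scale1r subrK => hq.
have := q_ge0 (x - d); have := q_ge0 d; nra.
Qed.

Context (f : U -> R) (fD : forall x y, f (x + y) = f x + f y)
  (fZ : forall t x, f (t *: x) = t * f x)
  (fB : forall b, B b -> f b = 0)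
  (f_le : forall y x, f (y * x) <= N y * Num.sqrt (q x))
  (BM : forall x y, B x -> B y -> B (x * y)).

Let fN x : f (- x) = - f x.
Proof. by rewrite -scaleN1r fZ mulN1r. Qed.

Let sqrt_q_le x : Num.sqrt (q x) <= N x.
Proof.
by rewrite -[leRHS]ger0_norm // -sqrtr_sqr; apply: ler_wsqrtr; exact: q_le.
Qed.

(** [a c = a (c - p) + (a - b) p + b p] with [p] a near-projection of [c], where
    [f] vanishes on the last term. *)
Lemma functional_mul_le a c b d : B b -> B d ->
  f (a * c) <= N a * N (c - d) + N (a - b) * N c.
Proof.
move=> Bb Bd.
apply: (@le_trans _ _ (N a * Num.sqrt (q (c - d)) + N (a - b) * Num.sqrt (q c))).
  apply: (@sqrt_perturb_le _ _ _ _ _ _ 1 (2 + 2 * q c)) => //.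
    by have := q_ge0 c; lra.
  move=> e e0 e1; have [p [Bp hp hip qp]] := near_projection c e0 e1.
  have -> : a * c = a * (c - p) + (a - b) * p + b * p.
    by rewrite mulrBr mulrBl addrA !subrK.
  rewrite !fD (fB (BM Bb Bp)) addr0; apply: lerD.
    apply: le_trans (f_le _ _) _; apply: ler_wpM2l => //; apply: ler_wsqrtr.
    by rewrite mulr1; exact: hp.
  apply: le_trans (f_le _ _) _; apply: ler_wpM2l => //; apply: ler_wsqrtr.
  have := hip p Bp; rewrite ler_norml => /andP[h1 _].
  have := qD (c - p) p 1; rewrite scale1r subrK => hq.
  have := q_ge0 (c - p); have := ler_wpM2l (ltW e0) qp; lra.
by apply: lerD; apply: ler_wpM2l.
Qed.

(** The reflection of [x] in [B] is nearly isometric. *)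
Let q_reflect x d m : `|ip (x - d) d| <= m -> q (x - d - d) <= q x + 2 * m.
Proof.
rewrite ler_norml => /andP[h _].
have := qD (x - d) d 1; have := qD (x - d) d (-1).
by rewrite scaleN1r scale1r subrK; lra.
Qed.

(** Here [x - 2 d] and [t x - 2 d'] are, up to sign, the reflections of [x] and
    [t x] in [B].  The difference of [f (x t (x - 2 d))] and [f (x (t x - 2 d'))]
    is [2 f x], since [a x = x a = u] and [f d = 0]. *)
Lemma functional_inv_le u a x b : (forall y, B y -> B (st y)) ->
  B u -> (forall y, B y -> u * y = y) -> u * x = x -> x * u = x ->
  a * x = u -> x * a = u -> B b -> f x <= N x ^+ 2 * N (a - b).
Proof.
move=> Bst Bu uB ux xu ax xa Bb.
pose t := a - b.
(* Twice a bound for [q (st b * d')] below, independent of the accuracy [e]. *)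
pose k := 4 * q (st b * u) + 4 * N (st b * b) ^+ 2 * (2 * q x + 1).
have k0 : 0 <= k.
  have := q_ge0 (st b * u); have := sqr_ge0 (N (st b * b)); have := q_ge0 x.
  rewrite /k; nra.
have : 2 * f x <=
    N x * Num.sqrt (q (t * x)) + N (x * t) * Num.sqrt (q x).
  apply: (@sqrt_perturb_le _ _ _ _ _ _ (2 + k) (4 + 4 * q x)) => //.
  - by lra.
  - by have := q_ge0 x; lra.
  move=> e e0 e1; have [d [Bd _ hip qd]] := near_projection x e0 e1.
  (* [a x = u] lies in [B], so [u - b d] is a near-projection of
     [t x = u - b x]. *)
  pose d' := u - b * d.
  have Bd' : B d' by apply: BB => //; exact: BM.
  have tx : t * x - d' = - (b * (x - d)).
    by rewrite /t /d' mulrBl ax mulrBr; zmod_cancel.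
  have bd' : q (st b * d') <= 2^-1 * k.
    rewrite /d' mulrBr mulrA.
    have := q_ge0 (st b * u + st b * b * d).
    have := qD (st b * u) (st b * b * d) 1.
    have := qD (st b * u) (st b * b * d) (-1).
    rewrite scaleN1r scale1r.
    have := qM (st b * b) d.
    have := ler_wpM2l (sqr_ge0 (N (st b * b))) qd.
    rewrite /k; lra.
  have ipE : ip (t * x - d') d' = - ip (x - d) (st b * d').
    rewrite /ip tx -scaleN1r stZ -scalerAl -scalerAr -scalerDr phiZ mulN1r.
    by rewrite !stM stK !mulrA.
  have -> : 2 * f x =
      f (- x * (t * x - d' - d')) + f (x * t * (x - d - d)).
    rewrite -fD.
    have -> : - x * (t * x - d' - d') + x * t * (x - d - d) = x + x - (d + d).
      have xd' : x * d' = x - x * (b * d) by rewrite mulrBr xu.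
      have xtd : x * t * d = d - x * (b * d).
        by rewrite -mulrA mulrBl mulrBr mulrA xa uB.
      rewrite mulNr [x * (t * x - d' - d')]mulrBr [x * (t * x - d')]mulrBr.
      rewrite [x * t * (x - d - d)]mulrBr [x * t * (x - d)]mulrBr xd' xtd !mulrA.
      by zmod_cancel.
    by rewrite !(fD, fN) (fB Bd); lra.
  apply: lerD; apply: le_trans (f_le _ _) _.
    rewrite NN; apply: ler_wpM2l => //; apply: ler_wsqrtr.
    have h : `|ip (t * x - d') d'| <= e * (1 + 2^-1 * k).
      rewrite ipE normrN; apply: le_trans (hip _ (BM (Bst _ Bb) Bd')) _.
      by rewrite ler_pM2l // lerD2l.
    by apply: le_trans (q_reflect h) _; lra.
  apply: ler_wpM2l => //; apply: ler_wsqrtr.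
  apply: le_trans (q_reflect (hip d Bd)) _.
  have := ler_wpM2l (ltW e0) qd; lra.
have h1 : N x * Num.sqrt (q (t * x)) <= N x * (N t * N x).
  by apply: ler_wpM2l => //; apply: le_trans (sqrt_q_le _) (NM _ _).
have h2 : N (x * t) * Num.sqrt (q x) <= N x * N t * N x.
  by apply: ler_pM => //; exact: sqrtr_ge0.
rewrite -/t expr2; lra.
Qed.
End NearProjection.

Context (BM : forall x y, B x -> B y -> B (x * y)).

Theorem dist_mul_le a c b d m : (forall y, B y -> m <= N (a * c - y)) ->
  B b -> B d -> m <= N a * N (c - d) + N (a - b) * N c.
Proof.
move=> /separating_functional[f [phi [[fD fZ] [pD pZ] [pN p0] [fB mf] fle]]] Bb Bd.
apply: le_trans mf _.
exact: (functional_mul_le pD pZ pN p0 fD fB fle BM).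
Qed.

Theorem dist_inv_le u a x b m : (forall y, B y -> B (st y)) ->
  B u -> (forall y, B y -> u * y = y) -> u * x = x -> x * u = x ->
  a * x = u -> x * a = u -> (forall y, B y -> m <= N (x - y)) ->
  B b -> m <= N x ^+ 2 * N (a - b).
Proof.
move=> Bst Bu uB ux xu ax xa.
move=> /separating_functional[f [phi [[fD fZ] [pD pZ] [pN p0] [fB mf] fle]]] Bb.
apply: le_trans mf _.
exact: (functional_inv_le pD pZ pN p0 fD fZ fB fle BM Bst Bu uB ux xu ax xa).
Qed.
End Subspace.

End UnitalCStar.

(** * Elementary properties of the norm *)

Section ComplexNorm.
Local Open Scope complex_scope.
Context (R : realType) (A : cstarAlgType R).
Implicit Types (a b x y : A) (k l : R[i]).

Definition cabs k : R := complex.Re `|k|.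

Lemma cabsE k : (cabs k)%:C = `|k|.
Proof. by rewrite /cabs RRe_real ?normr_real. Qed.

Lemma cabs_ge0 k : 0 <= cabs k.
Proof. by rewrite -ler0c cabsE. Qed.

Lemma cabsD k l : cabs (k + l) <= cabs k + cabs l.
Proof. by rewrite -lecR rmorphD /= !cabsE ler_normD. Qed.

Lemma cabsM k l : cabs (k * l) = cabs k * cabs l.
Proof. by apply: complexI; rewrite rmorphM /= !cabsE normrM. Qed.

Lemma cabsR (r : R) : cabs r%:C = `|r|.
Proof. by rewrite /cabs normc_def /= expr0n addr0 sqrtr_sqr. Qed.

Lemma cabs_conj k : cabs k^* = cabs k.
Proof. by rewrite /cabs normcJ. Qed.

Lemma cabs_eq0 k : cabs k = 0 -> k = 0.
Proof. by move=> k0; apply/eqP; rewrite -normr_eq0 -cabsE k0. Qed.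

Lemma cabs_Re_Im k : `|complex.Re k| <= cabs k /\ `|complex.Im k| <= cabs k.
Proof.
rewrite /cabs normc_def /=; split; rewrite -sqrtr_sqr ler_wsqrtr //.
  by rewrite lerDl sqr_ge0.
by rewrite lerDr sqr_ge0.
Qed.

Lemma cabs_le_Re_Im k : cabs k <= `|complex.Re k| + `|complex.Im k|.
Proof.
rewrite -[leRHS]ger0_norm ?addr_ge0 // -sqrtr_sqr /cabs normc_def /=.
apply: ler_wsqrtr; rewrite sqrrD !real_normK ?num_real //.
by rewrite [leRHS]addrAC lerDl mulrn_wge0 // mulr_ge0.
Qed.

Lemma cnorm_ge0 a : 0 <= cnorm a.
Proof. by rewrite -ler0c cnormE. Qed.

Lemma cnormD a b : cnorm (a + b) <= cnorm a + cnorm b.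
Proof. by rewrite -lecR rmorphD /= !cnormE ler_normD. Qed.

Lemma cnormZ k a : cnorm (k *: a) = cabs k * cnorm a.
Proof. by apply: complexI; rewrite rmorphM /= !cnormE cabsE normrZ. Qed.

Lemma cnormN a : cnorm (- a) = cnorm a.
Proof. by rewrite /cnorm normrN. Qed.

Lemma cnorm_eq0 a : cnorm a = 0 -> a = 0.
Proof. by move=> a0; apply/eqP; rewrite -normr_eq0 -cnormE a0. Qed.

Lemma cnorm0 : cnorm (0 : A) = 0.
Proof. by rewrite /cnorm normr0. Qed.

Lemma cnormM a b : cnorm (a * b)%g <= cnorm a * cnorm b.
Proof. by rewrite -lecR rmorphM /= !cnormE; exact: cstar_normM. Qed.

Lemma cnorm_starM a : cnorm (star a * a)%g = cnorm a ^+ 2.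
Proof. by apply: complexI; rewrite rmorphXn /= !cnormE; exact: cstar_identity. Qed.

Lemma cnorm_le_star a : cnorm a <= cnorm (star a).
Proof.
have h : cnorm a ^+ 2 <= cnorm (star a) * cnorm a.
  by rewrite -cnorm_starM; exact: cnormM.
have [->|n0] := eqVneq (cnorm a) 0; first exact: cnorm_ge0.
have p0 : 0 < cnorm a by rewrite lt_neqAle eq_sym n0 cnorm_ge0.
by rewrite -(ler_pM2r p0) -expr2.
Qed.

Lemma cnorm_star a : cnorm (star a) = cnorm a.
Proof.
apply/eqP; rewrite eq_le cnorm_le_star andbT.
by rewrite -{2}(starK a) cnorm_le_star.
Qed.

(** The choice [x = a*] shows that left multiplication is isometric. *)
Lemma cnorm_left_mul_le a m : 0 <= m ->
  (forall x, cnorm (a * x)%g <= m * cnorm x) -> cnorm a <= m.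
Proof.
move=> m0 h; have := h (star a).
rewrite -{1}[a]starK cnorm_starM cnorm_star expr2.
have [->//|n0] := eqVneq (cnorm a) 0.
by rewrite ler_pM2r // lt_neqAle eq_sym n0 cnorm_ge0.
Qed.

Lemma cmul0r x : (0 * x = 0 :> A)%g.
Proof. by rewrite -[in LHS](scale0r (0 : A)) cstar_mulZl scale0r. Qed.

Lemma cmulr0 x : (x * 0 = 0 :> A)%g.
Proof. by rewrite -[in LHS](scale0r (0 : A)) cstar_mulZr scale0r. Qed.

End ComplexNorm.

(** * The unitization *)

(** An alias of the product type, which keeps the unital multiplication apart from
    the componentwise structures of products. *)
Definition unitization (R : realType) (A : cstarAlgType R) : Type :=
  (A * R[i])%type.

HB.instance Definition _ (R : realType) (A : cstarAlgType R) :=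
  GRing.Zmodule.copy (unitization A) (A * R[i])%type.

Section Unitization.
Local Open Scope complex_scope.
Context (R : realType) (A : cstarAlgType R).
Notation U := (unitization A).
Implicit Types (u v w : U) (x y : A) (r : R).

Definition umul u v : U :=
  ((u.1 * v.1)%g + (u.2 *: v.1 + v.2 *: u.1), u.2 * v.2).
Definition uone : U := (0, 1).
Definition uscale r u : U := (r%:C *: u.1, r%:C * u.2).

Let umulA : associative umul.
Proof.
move=> [x k] [y l] [z m]; rewrite /umul /=; congr pair; last exact: mulrA.
rewrite !(cstar_mulDl, cstar_mulDr) !(cstar_mulZl, cstar_mulZr) mulgA.
rewrite !scalerDr !scalerA [m * k]mulrC [m * l]mulrC; zmod_cancel.
Qed.

Let umul1l : left_id uone umul.
Proof. by case=> x k; rewrite /umul /= cmul0r scale1r scaler0 mul1r add0r addr0. Qed.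

Let umul1r : right_id uone umul.
Proof. by case=> x k; rewrite /umul /= cmulr0 scale1r scaler0 mulr1 !add0r. Qed.

Let umulDl : left_distributive umul +%R.
Proof.
move=> [x k] [y l] [z m]; rewrite /umul /=; congr pair; last exact: mulrDl.
rewrite cstar_mulDl scalerDl scalerDr; zmod_cancel.
Qed.

Let umulDr : right_distributive umul +%R.
Proof.
move=> [x k] [y l] [z m]; rewrite /umul /=; congr pair; last exact: mulrDr.
rewrite cstar_mulDr scalerDl scalerDr; zmod_cancel.
Qed.

Let uone_neq0 : uone != 0.
Proof. by apply/eqP => -[] /eqP; rewrite oner_eq0. Qed.

HB.instance Definition _ := GRing.Zmodule_isNzRing.Build U
  umulA umul1l umul1r umulDl umulDr uone_neq0.

Let uscaleA r s u : uscale r (uscale s u) = uscale (r * s) u.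
Proof. by rewrite /uscale /= rmorphM scalerA mulrA. Qed.

Let uscale1 : left_id 1 uscale.
Proof. by case=> x k; rewrite /uscale rmorph1 scale1r mul1r. Qed.

Let uscaleDr : right_distributive uscale +%R.
Proof. by move=> r u v; rewrite /uscale /= scalerDr mulrDr. Qed.

Let uscaleDl u : {morph uscale^~ u : r s / r + s}.
Proof. by move=> r s; rewrite /uscale /= rmorphD scalerDl mulrDl. Qed.

HB.instance Definition _ := GRing.Zmodule_isLmodule.Build R U
  uscaleA uscale1 uscaleDr uscaleDl.

Let uscaleAl r u v : r *: (u * v) = (r *: u) * v.
Proof.
congr pair; last exact: mulrA.
rewrite /= cstar_mulZl !scalerDr !scalerA; congr (_ + (_ + _ *: _)).
exact: mulrC.
Qed.

HB.instance Definition _ := GRing.Lmodule_isLalgebra.Build R U uscaleAl.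

Let uscaleAr r u v : r *: (u * v) = u * (r *: v).
Proof.
congr pair; last exact: mulrCA.
rewrite /= cstar_mulZr !scalerDr !scalerA; congr (_ + (_ *: _ + _)).
exact: mulrC.
Qed.

HB.instance Definition _ := GRing.Lalgebra_isAlgebra.Build R U uscaleAr.

Definition uact u x : A := (u.1 * x)%g + u.2 *: x.

Let unorm_bound u : set R :=
  [set m | [/\ 0 <= m, cabs u.2 <= m & forall x, cnorm (uact u x) <= m * cnorm x]].

(** The larger of the norm of left multiplication by [u] and of the scalar part.
    The scalar part makes this a norm even when the algebra already has a unit,
    in which case left multiplication is not faithful. *)
Definition unorm u : R := inf (unorm_bound u).

Definition ustar u : U := (star u.1, (u.2)^*).

Let unorm_has_lb u : has_lbound (unorm_bound u).
Proof. by exists 0 => m []. Qed.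

Lemma unorm_le u m : 0 <= m -> cabs u.2 <= m ->
  (forall x, cnorm (uact u x) <= m * cnorm x) -> unorm u <= m.
Proof. by move=> *; apply: ge_inf. Qed.

Let unorm_bound_nonempty u : unorm_bound u !=set0.
Proof.
exists (cnorm u.1 + cabs u.2); split.
- by rewrite addr_ge0 ?cnorm_ge0 ?cabs_ge0.
- by rewrite lerDr cnorm_ge0.
- move=> x; rewrite /uact; apply: le_trans (cnormD _ _) _.
  by rewrite cnormZ mulrDl lerD2r cnormM.
Qed.

Lemma unorm_ge0 u : 0 <= unorm u.
Proof. by apply: lb_le_inf => // m []. Qed.

Lemma cabs_le_unorm u : cabs u.2 <= unorm u.
Proof. by apply: lb_le_inf => // m []. Qed.

Lemma cnorm_uact_le u x : cnorm (uact u x) <= unorm u * cnorm x.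
Proof.
have [x0|n0] := eqVneq (cnorm x) 0.
  by rewrite x0 (cnorm_eq0 x0) /uact cmulr0 scaler0 addr0 cnorm0 mulr0.
have x0 : 0 < cnorm x by rewrite lt_neqAle eq_sym n0 cnorm_ge0.
rewrite -ler_pdivrMr //; apply: lb_le_inf => // m [_ _ h].
by rewrite ler_pdivrMr.
Qed.

Lemma unorm_le_add u : unorm u <= cnorm u.1 + cabs u.2.
Proof.
apply: unorm_le.
- by rewrite addr_ge0 ?cnorm_ge0 ?cabs_ge0.
- by rewrite lerDr cnorm_ge0.
- move=> x; rewrite /uact; apply: le_trans (cnormD _ _) _.
  by rewrite cnormZ mulrDl lerD2r cnormM.
Qed.

Lemma cnorm_le_unorm u : cnorm u.1 <= 2 * unorm u.
Proof.
apply: cnorm_left_mul_le => [|x]; first by rewrite mulr_ge0 ?unorm_ge0.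
have -> : (u.1 * x)%g = uact u x - u.2 *: x by rewrite /uact addrK.
apply: le_trans (cnormD _ _) _; rewrite cnormN cnormZ.
have := cnorm_uact_le u x.
have := ler_wpM2r (cnorm_ge0 x) (cabs_le_unorm u); lra.
Qed.

Definition uinj x : U := (x, 0).

Lemma unorm_inj x : unorm (uinj x) = cnorm x.
Proof.
apply/eqP; rewrite eq_le; apply/andP; split.
  by apply: le_trans (unorm_le_add _) _; rewrite /= (cabsR 0) normr0 addr0.
apply: cnorm_left_mul_le => [|y]; first exact: unorm_ge0.
by have := cnorm_uact_le (uinj x) y; rewrite /uact /= scale0r addr0.
Qed.

Lemma uactD u v x : uact (u + v) x = uact u x + uact v x.
Proof. by rewrite /uact /= cstar_mulDl scalerDl addrACA. Qed.

Lemma uactZ r u x : uact (r *: u) x = r%:C *: uact u x.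
Proof. by rewrite /uact /= cstar_mulZl scalerDr scalerA. Qed.

Lemma uactM u v x : uact (u * v) x = uact u (uact v x).
Proof.
rewrite /uact /= !(cstar_mulDl, cstar_mulDr) !(cstar_mulZl, cstar_mulZr) mulgA.
by rewrite !scalerDr scalerA; zmod_cancel.
Qed.

Lemma star_uact u x y :
  (star (uact u x) * uact u y = star x * uact (ustar u * u)%R y)%g.
Proof.
rewrite uactM; move: (uact u y) => z.
rewrite /uact starD starM starZ cstar_mulDl cstar_mulDr.
by rewrite cstar_mulZl cstar_mulZr mulgA.
Qed.

Lemma unormD u v : unorm (u + v) <= unorm u + unorm v.
Proof.
apply: unorm_le; first by rewrite addr_ge0 ?unorm_ge0.
  by apply: le_trans (cabsD _ _) _; apply: lerD; exact: cabs_le_unorm.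
move=> x; rewrite uactD mulrDl; apply: le_trans (cnormD _ _) _.
by apply: lerD; exact: cnorm_uact_le.
Qed.

Lemma unormM u v : unorm (u * v) <= unorm u * unorm v.
Proof.
apply: unorm_le; first by rewrite mulr_ge0 ?unorm_ge0.
  by rewrite /= cabsM; apply: ler_pM; rewrite ?cabs_ge0 ?cabs_le_unorm.
move=> x; rewrite uactM; apply: le_trans (cnorm_uact_le _ _) _.
by rewrite -mulrA ler_wpM2l ?unorm_ge0 // cnorm_uact_le.
Qed.

Lemma unormZ r u : unorm (r *: u) = `|r| * unorm u.
Proof.
have le s v : unorm (s *: v) <= `|s| * unorm v.
  apply: unorm_le; first by rewrite mulr_ge0 ?unorm_ge0.
    by rewrite /= cabsM cabsR ler_wpM2l // cabs_le_unorm.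
  by move=> x; rewrite uactZ cnormZ cabsR -mulrA ler_wpM2l // cnorm_uact_le.
have [->|r0] := eqVneq r 0.
  apply/eqP; rewrite eq_le le /= normr0 mul0r; exact: unorm_ge0.
apply/eqP; rewrite eq_le le /= -ler_pdivlMl ?normr_gt0 // -normfV.
by apply: le_trans _ (le _ _); rewrite scalerA mulVf // scale1r.
Qed.

(** [|u x|^2 = |x* (u* u) x|] for [x] in the algebra, and the scalar parts satisfy
    the C*-identity. *)
Lemma unorm_star_sq_le u : unorm u ^+ 2 <= unorm (ustar u * u).
Proof.
set n := unorm (ustar u * u); have n0 : 0 <= n by exact: unorm_ge0.
rewrite -(sqr_sqrtr n0) ler_sqr ?nnegrE ?unorm_ge0 ?sqrtr_ge0 //.
apply: unorm_le; first exact: sqrtr_ge0.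
  rewrite -ler_sqr ?nnegrE ?sqrtr_ge0 ?cabs_ge0 // sqr_sqrtr //.
  by have := cabs_le_unorm (ustar u * u); rewrite /= cabsM cabs_conj -expr2.
move=> x; rewrite -ler_sqr ?nnegrE ?mulr_ge0 ?sqrtr_ge0 ?cnorm_ge0 //.
rewrite exprMn sqr_sqrtr // -cnorm_starM star_uact.
apply: le_trans (cnormM _ _) _; rewrite cnorm_star expr2 mulrA [n * _]mulrC -mulrA.
by rewrite ler_wpM2l ?cnorm_ge0 // cnorm_uact_le.
Qed.

Lemma cnorm_complete (a : nat -> A) :
  (forall e : R, 0 < e -> exists n,
    forall m, (n <= m)%N -> cnorm (a m - a n) <= e) ->
  exists l, forall e : R, 0 < e -> exists n,
    forall m, (n <= m)%N -> cnorm (a m - l) <= e.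
Proof.
move=> ha.
have half e : 0 < e :> R[i] -> 0 < complex.Re e / 2.
  by rewrite ltcE /= => /andP[_ ?]; rewrite divr_gt0.
have e_gt e : 0 < e :> R[i] -> (complex.Re e / 2)%:C < e.
  by move=> e0; have := half _ e0; move: e0; rewrite !ltcE /= => /andP[-> ?] ?; lra.
have : cvg (a @ \oo).
  apply/cauchy_cvgP/cauchy_exP => e e0.
  have [n hn] := ha _ (half _ e0).
  exists (a n), n => // m /= nm; rewrite -ball_normE /= distrC -cnormE.
  by apply: le_lt_trans (e_gt _ e0); rewrite lecR; exact: hn.
move=> /cvg_ex[l /cvgrPdist_le hl]; exists l => e e0.
have [|n _ hn] := hl e%:C; first by rewrite ltcR.
by exists n => m nm; rewrite -lecR cnormE distrC; exact: hn.
Qed.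

Lemma real_complete (a : nat -> R) :
  (forall e : R, 0 < e -> exists n,
    forall m, (n <= m)%N -> `|a m - a n| <= e) ->
  exists l, forall e : R, 0 < e -> exists n,
    forall m, (n <= m)%N -> `|a m - l| <= e.
Proof.
move=> ha.
have : cvg (a @ \oo).
  apply/cauchy_cvgP/cauchy_exP => e e0.
  have [|n hn] := ha (e / 2); first by rewrite divr_gt0.
  exists (a n), n => // m /= nm; rewrite -ball_normE /= distrC.
  by apply: le_lt_trans (hn _ nm) _; rewrite ltr_pdivrMr // ltr_pMr // ltr1n.
move=> /cvg_ex[l /cvgrPdist_le hl]; exists l => e e0.
by have [n _ hn] := hl e e0; exists n => m nm; rewrite distrC; exact: hn.
Qed.

(** Both components of a Cauchy sequence are Cauchy, by [cnorm_le_unorm] and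
    [cabs_le_unorm]. *)
Lemma unorm_complete (u : nat -> U) :
  (forall e : R, 0 < e -> exists n,
    forall m, (n <= m)%N -> unorm (u m - u n) <= e) ->
  exists l, forall e : R, 0 < e -> exists n,
    forall m, (n <= m)%N -> unorm (u m - l) <= e.
Proof.
move=> hu.
have [e e0|a ha] := @cnorm_complete (fun m => (u m).1).
  have [|n hn] := hu (e / 2); first by rewrite divr_gt0.
  exists n => m nm; apply: le_trans (cnorm_le_unorm (u m - u n)) _.
  by rewrite mulrC -ler_pdivlMr //; exact: hn.
have [e e0|k hk] := @real_complete (fun m => complex.Re (u m).2).
  have [n hn] := hu e e0; exists n => m nm.
  apply: le_trans (hn m nm); apply: le_trans (cabs_le_unorm _).
  by have [h _] := cabs_Re_Im (u m - u n).2; rewrite -raddfB.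
have [e e0|l hl] := @real_complete (fun m => complex.Im (u m).2).
  have [n hn] := hu e e0; exists n => m nm.
  apply: le_trans (hn m nm); apply: le_trans (cabs_le_unorm _).
  by have [_ h] := cabs_Re_Im (u m - u n).2; rewrite -raddfB.
exists (a, k +i* l) => e e0.
have e3 : 0 < e / 3 by rewrite divr_gt0.
have [n1 h1] := ha _ e3; have [n2 h2] := hk _ e3; have [n3 h3] := hl _ e3.
exists (maxn n1 (maxn n2 n3)) => m; rewrite !geq_max => /and3P[m1 m2 m3].
apply: le_trans (unorm_le_add _) _.
have := cabs_le_Re_Im (u m - (a, k +i* l)).2.
have := h1 m m1; have := h2 m m2; have := h3 m m3.
rewrite /=; case: (u m) => x [k' l'] /=; lra.
Qed.

Theorem unitization_unital_cstar : unital_cstar unorm ustar (0, 'i).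
Proof.
split.
- case=> x k u0; congr pair.
    have := cnorm_le_unorm (x, k); rewrite u0 mulr0 => x0.
    by apply/cnorm_eq0/le_anti; rewrite cnorm_ge0 x0.
  have := cabs_le_unorm (x, k); rewrite u0 => k0.
  by apply/cabs_eq0/le_anti; rewrite cabs_ge0 k0.
- exact: unormD.
- exact: unormZ.
- exact: unormM.
- exact: unorm_star_sq_le.
- by case=> x k; rewrite /ustar /= starK conjcK.
- by move=> u v; rewrite /ustar /= starD rmorphD.
- move=> r u; congr pair; last by rewrite /= rmorphM /= oppr0.
  by rewrite /= starZ; congr (_ *: _); exact: conjc_real.
- move=> u v; congr pair; last by rewrite /= rmorphM mulrC.
  by rewrite /= !starD !starZ starM [X in _ + X]addrC.
- move=> u; congr pair; last exact: mulrC.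
  by rewrite /= cmul0r cmulr0 scaler0 addr0 add0r !add0r.
- congr pair; first by rewrite /= cmul0r scaler0 !addr0 oppr0.
  by rewrite /= -expr2 sqr_i.
- congr pair; last by apply/eqP; rewrite eq_complex /= oppr0 !eqxx.
  by rewrite /= oppr0; apply: cnorm_eq0; rewrite cnorm_star cnorm0.
- exact: unorm_complete.
Qed.
End Unitization.

(** * The quotient seminorm *)

Section Embedding.
Context (R : realType) (A : cstarAlgType R) (B : set A) (hB : cstar_subalgebra B).

Let B' : set (unitization A) := [set uinj b | b in B].

Let uinjM (x y : A) : uinj x * uinj y = uinj (x * y)%g.
Proof. by congr pair; rewrite /= ?mulr0 // !scale0r !addr0. Qed.

Let uinjB (x y : A) : uinj x - uinj y = uinj (x - y).
Proof. by congr pair; rewrite /= subr0. Qed.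

Let B'0 : B' 0.
Proof. by exists 0 => //; exact: cstar_sub0. Qed.

Let B'D x y : B' x -> B' y -> B' (x + y).
Proof.
move=> [b Bb <-] [d Bd <-]; exists (b + d); first exact: cstar_subD.
by congr pair; rewrite /= addr0.
Qed.

Let B'Z (r : R) x : B' x -> B' (r *: x).
Proof.
move=> [b Bb <-]; exists (r%:C%C *: b); first exact: cstar_subZ.
by congr pair; rewrite /= mulr0.
Qed.

Let B'M x y : B' x -> B' y -> B' (x * y).
Proof.
move=> [b Bb <-] [d Bd <-]; exists (b * d)%g; first exact: cstar_subM.
by rewrite uinjM.
Qed.

Let B'star x : B' x -> B' (ustar x).
Proof.
move=> [b Bb <-]; exists (star b); first exact: cstar_sub_star.
by congr pair; exact/esym/conjc0.
Qed.

Lemma quotient_seminorm_le a b : B b -> quotient_seminorm B a <= cnorm (a - b).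
Proof.
move=> Bb; apply: ge_inf; last by exists b.
by exists 0 => _ [d _ <-]; exact: cnorm_ge0.
Qed.

Lemma quotient_seminorm_ge a m : (forall b, B b -> m <= cnorm (a - b)) ->
  m <= quotient_seminorm B a.
Proof.
move=> h; apply: lb_le_inf; first by exists (cnorm (a - 0)), 0 => //; exact: cstar_sub0.
by move=> _ [b Bb <-]; exact: h.
Qed.

Let le_uinj a m : (forall b, B b -> m <= cnorm (a - b)) ->
  forall y, B' y -> m <= unorm (uinj a - y).
Proof. by move=> h _ [b Bb <-]; rewrite uinjB unorm_inj; exact: h. Qed.

Lemma quotient_seminorm_ge0 a : 0 <= quotient_seminorm B a.
Proof. by apply: quotient_seminorm_ge => b _; exact: cnorm_ge0. Qed.

Lemma quotient_seminorm_leibniz : leibniz (quotient_seminorm B).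
Proof.
move=> a c; set m := quotient_seminorm B (a * c)%g.
have key b d : B b -> B d ->
    m <= cnorm a * cnorm (c - d) + cnorm (a - b) * cnorm c.
  move=> Bb Bd.
  have hm : forall y, B' y -> m <= unorm (uinj a * uinj c - y).
    by rewrite uinjM; apply: le_uinj => y; exact: quotient_seminorm_le.
  have B'b : B' (uinj b) by exists b.
  have B'd : B' (uinj d) by exists d.
  have := dist_mul_le (unitization_unital_cstar A) B'0 B'D B'Z B'M hm B'b B'd.
  by rewrite !uinjB !unorm_inj.
have approx a' e : 0 < e ->
    exists2 b, B b & cnorm (a' - b) < quotient_seminorm B a' + e.
  move=> e0; have [||_ [b Bb <-] hb] := @inf_lt _
    [set cnorm (a' - b) | b in B] (quotient_seminorm B a' + e).
  - by exists (cnorm (a' - 0)), 0 => //; exact: cstar_sub0.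
  - by rewrite ltrDl.
  - by exists b.
apply/ler_addgt0Pl => e e0.
have s0 : 0 < cnorm a + cnorm c + 1.
  by have := cnorm_ge0 a; have := cnorm_ge0 c; lra.
have d0 : 0 < e / (cnorm a + cnorm c + 1) by rewrite divr_gt0.
have [b Bb hb] := approx a _ d0; have [d Bd hd] := approx c _ d0.
have h1 := ler_wpM2l (cnorm_ge0 a) (ltW hd).
have h2 := ler_wpM2r (cnorm_ge0 c) (ltW hb).
have h3 : e / (cnorm a + cnorm c + 1) * (cnorm a + cnorm c + 1) = e.
  by rewrite divfK // gt_eqF.
have := key b d Bb Bd; lra.
Qed.

Lemma quotient_seminorm_one u : B u -> quotient_seminorm B u = 0.
Proof.
move=> Bu; apply/le_anti; rewrite quotient_seminorm_ge0 andbT.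
by have := quotient_seminorm_le u Bu; rewrite subrr cnorm0.
Qed.

Lemma quotient_seminorm_inverse u a x : is_one u -> B u -> is_inverse u a x ->
  quotient_seminorm B x <= cnorm x ^+ 2 * quotient_seminorm B a.
Proof.
move=> u1 Bu [ax xa]; set m := quotient_seminorm B x.
have key b : B b -> m <= cnorm x ^+ 2 * cnorm (a - b).
  move=> Bb.
  have hm : forall y, B' y -> m <= unorm (uinj x - y).
    by apply: le_uinj => y; exact: quotient_seminorm_le.
  have B'b : B' (uinj b) by exists b.
  have B'u : B' (uinj u) by exists u.
  have uB y : B' y -> uinj u * y = y.
    by move=> [d _ <-]; rewrite uinjM (u1 d).1.
  have ux : uinj u * uinj x = uinj x by rewrite uinjM (u1 x).1.
  have xu : uinj x * uinj u = uinj x by rewrite uinjM (u1 x).2.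
  have ax' : uinj a * uinj x = uinj u by rewrite uinjM ax.
  have xa' : uinj x * uinj a = uinj u by rewrite uinjM xa.
  have := dist_inv_le (unitization_unital_cstar A) B'0 B'D B'Z B'M
    B'star B'u uB ux xu ax' xa' hm B'b.
  by rewrite uinjB !unorm_inj.
have [x0|n0] := eqVneq (cnorm x) 0.
  have := key 0 (cstar_sub0 hB); rewrite x0 expr0n !mul0r.
  by [].
have p0 : 0 < cnorm x ^+ 2 by rewrite exprn_gt0 // lt_neqAle eq_sym n0 cnorm_ge0.
rewrite -ler_pdivrMl //; apply: quotient_seminorm_ge => b Bb.
by rewrite ler_pdivrMl //; exact: key.
Qed.
End Embedding.

Theorem theorem3p1 (R : realType) (A : cstarAlgType R) (B : set A)
    (hB : cstar_subalgebra B)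
    (hu : contains_bounded_approximate_identity B) :
  leibniz (quotient_seminorm B) /\
  (forall one : A, is_one one -> B one ->
     strongly_leibniz one (quotient_seminorm B)).
Proof.
split=> [|one h1 Bone]; first exact: quotient_seminorm_leibniz.
split; [exact: quotient_seminorm_leibniz | exact: quotient_seminorm_one |].
by move=> a a'; exact: quotient_seminorm_inverse.
Qed.
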